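(* Let $m\ge2$. The Grothendieck ring $K_0(\mathcal{B}_{4m})$ has the following fusion rules, where $i,j\in\{1,\dots,m-1\}$ and $\delta,\varepsilon\in\{1,-1\}$. If $j$ is even, $$\pi_i(u,v)\otimes\pi_j(x,y)=\begin{cases}\pi_{i-j}(uy,vx)\oplus\pi_{i+j}(ux,vy)& i+j\le m-1,\ i-j\ge0\\ \pi_{j-i}(vx,uy)\oplus\pi_{i+j}(ux,vy)& i+j\le m-1,\ i-j\le0\\ \pi_{i-j}(uy,vx)\oplus\pi_{2m-i-j}(vy,ux)& i+j>m-1,\ i-j\ge0\\ \pi_{j-i}(vx,uy)\oplus\pi_{2m-i-j}(vy,ux)& i+j>m-1,\ i-j\le0,\end{cases}$$ and if $j$ is odd, $$\pi_i(u,v)\otimes\pi_j(x,y)=\begin{cases}\pi_{i-j}(\lambda^ivy,ux)\oplus\pi_{i+j}(\lambda^ivx,uy)& i+j\le m-1,\ i-j\ge0\\ \pi_{j-i}(ux,\lambda^ivy)\oplus\pi_{i+j}(\lambda^ivx,uy)& i+j\le m-1,\ i-j\le0\\ \pi_{i-j}(\lambda^ivy,ux)\oplus\pi_{2m-i-j}(uy,\lambda^ivx)& i+j>m-1,\ i-j\ge0\\ \pi_{j-i}(ux,\lambda^ivy)\oplus\pi_{2m-i-j}(uy,\lambda^ivx)& i+j>m-1,\ i-j\le0.\end{cases}$$ In addition, $$T_{\delta,\delta,1}(t)\otimes\pi_i(u,v)=\pi_i(tu,\delta tv),\qquad \pi_i(u,v)\otimes T_{\delta,\delta,1}(t)=\pi_i(ut,\delta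 vt),$$ $$T_{\delta,-\delta,(-1)^m}(t)\otimes\pi_i(u,v)=\pi_{m-i}(\delta(-1)^itv,tu),$$ $$\pi_i(u,v)\otimes T_{\delta,-\delta,(-1)^m}(t)=\pi_{m-i}(\delta(-1)^m vt,ut),$$ $$T_{\delta,-\delta,(-1)^m}(t)\otimes T_{\varepsilon,\varepsilon,1}(s)=T_{\delta\varepsilon,-\delta\varepsilon,(-1)^m}(ts),\qquad T_{\varepsilon,\varepsilon,1}(s)\otimes T_{\delta,-\delta,(-1)^m}(t)=T_{\varepsilon\delta,-\varepsilon\delta,(-1)^m}(st).$$
   Context: Ground field $\Bbbk=\mathbb{C}$. $K_0(H)$ is the Grothendieck ring of finite-dimensional left $H$-modules, with product given by tensor product. $\mathcal{B}_{4m}$ (Masuoka), $m\ge2$: generated by $a,s_+,s_-$ with $a$ central and grouplike, $a^2=1$, $s_\pm^2=1$, $(s_+s_-)^m=a$. With $e_0=(1+a)/2$, $e_1=(1-a)/2$: $\Delta(s_\pm)=s_\pm\otimes e_0s_\pm+s_\mp\otimes e_1s_\pm$, $\epsilon(s_\pm)=1$, $S(s_\pm)=e_0s_\pm+e_1s_\mp$. It has dimension $4m$. Let $\lambda=e^{\pi\sqrt{-1}/m}$. $T_{c_1,c_2,c_3}(t)$ is the one-dimensional module with basis $t$ on which $s_+,s_-,a$ act by $c_1,c_2,c_3$. For $0\le i\le m$, $\pi_i(u,v)$ is the two-dimensional module with basis $u,v$, the action of the generators being given by the matrices $\pi_i(s_+)=\begin{pmatrix}0&1\\ 1&0\end{pmatrix}$,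 $\pi_i(s_-)=\begin{pmatrix}0&\lambda^{-i}\\ \lambda^i&0\end{pmatrix}$, $\pi_i(a)=(-1)^i\,\mathrm{Id}$ (so $s_+u=v$, $s_+v=u$, $s_-u=\lambda^iv$, $s_-v=\lambda^{-i}u$); the modules $\pi_0,\pi_m$ are reducible. The elements in parentheses on the right-hand sides are the bases of the corresponding summands of the tensor product. We write $ux$ for $u\otimes x$, etc.
   Formalization: In the rule for π_i(u,v)⊗T_{δ,-δ,(-1)^m}(t), the stated basis (δ(-1)^m vt, ut) of π_{m-i} is wrong for odd m, since s_+(-δvt) = -λ^{-i}ut ≠ ut; for odd m the basis (ut, δλ^i vt) is used instead. *)

(* Defs.v *)
From HB Require Import structures.
From mathcomp Require Import all_boot all_order all_algebra.
From mathcomp Require Import generic_quotient ring_quotient.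
From mathcomp Require Import mxtens complex.
From mathcomp.multinomials Require Import freeg.
From mathcomp Require Import ring.
From mathcomp Require Import boolp reals trigo.

Set Implicit Arguments.
Unset Strict Implicit.
Unset Printing Implicit Defensive.

Import Order.TTheory GRing.Theory Num.Theory.

Local Open Scope ring_scope.
Local Open Scope quotient_scope.

Section Tensmx.
Variable F : comPzRingType.

Lemma tensmxDl m n p q (A B : 'M[F]_(m, n)) (C : 'M_(p, q)) :
  tensmx (A + B) C = tensmx A C + tensmx B C.
Proof. by apply/matrixP=> i j; rewrite !mxE mulrDl. Qed.

Lemma tensmxDr m n p q (A : 'M[F]_(m, n)) (B C : 'M_(p, q)) :
  tensmx A (B + C) = tensmx A B + tensmx A C.
Proof. by apply/matrixP=> i j; rewrite !mxE mulrDr. Qed.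

Lemma tensmx11 m n : tensmx (1%:M : 'M[F]_m) (1%:M : 'M_n) = 1%:M.
Proof.
apply/matrixP => i j.
case: (mxtens_indexP i)=> i0 i1; case: (mxtens_indexP j)=> j0 j1.
rewrite tensmxE !mxE -natrM mulnb; congr (_ %:R); congr nat_of_bool.
apply/andP/eqP => [[/eqP-> /eqP->] // | /(can_inj (@mxtens_indexK _ _)) []].
by move=> -> ->.
Qed.

End Tensmx.

(* The defining relations of B_{4m}, for a triple of elements of an algebra. *)
Definition B4m_rel (A : pzRingType) (m : nat) (sp sm a : A) : bool :=
  [&& a * sp == sp * a, a * sm == sm * a, a ^+ 2 == 1,
      sp ^+ 2 == 1, sm ^+ 2 == 1 & (sp * sm) ^+ m == a].

Section Modules.
Variables (F : numFieldType) (m : nat).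

(* As B_{4m} is presented by generators and relations, a left module
   structure on F^n is a triple of n x n matrices (the actions of s_+, s_-
   and a on column vectors) satisfying the defining relations. *)
Definition opdata : Type := {n : nat & ('M[F]_n * 'M[F]_n * 'M[F]_n)%type}.

Definition is_bmod (d : opdata) : bool :=
  let: existT n (sp, sm, a) := d in B4m_rel m sp sm a.

Record bmod := BMod { bdata :> opdata; bmodP : is_bmod bdata }.
HB.instance Definition _ := [isSub for bdata].
HB.instance Definition _ := [Choice of bmod by <:].

Definition dim (V : bmod) : nat := tag (bdata V).
Definition act_sp (V : bmod) : 'M[F]_(dim V) := (tagged (bdata V)).1.1.
Definition act_sm (V : bmod) : 'M[F]_(dim V) := (tagged (bdata V)).1.2.
Definition act_a (V : bmod) : 'M[F]_(dim V) := (tagged (bdata V)).2.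

Definition mk_bmod n (sp sm a : 'M[F]_n) (h : B4m_rel m sp sm a) : bmod :=
  @BMod (Tagged (fun n => ('M[F]_n * 'M[F]_n * 'M[F]_n)%type) (sp, sm, a)) h.

Lemma act_rel (V : bmod) : B4m_rel m (act_sp V) (act_sm V) (act_a V).
Proof. by case: V => -[n [[sp sm] a]]. Qed.

Definition act_e0 (V : bmod) : 'M[F]_(dim V) := 2^-1 *: (1%:M + act_a V).
Definition act_e1 (V : bmod) : 'M[F]_(dim V) := 2^-1 *: (1%:M - act_a V).

Lemma act_aa V : act_a V *m act_a V = 1%:M.
Proof. by case/and5P: (act_rel V) => _ _ /eqP. Qed.
Lemma act_spsp V : act_sp V *m act_sp V = 1%:M.
Proof. by case/and5P: (act_rel V) => _ _ _ /eqP. Qed.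
Lemma act_smsm V : act_sm V *m act_sm V = 1%:M.
Proof. by case/and5P: (act_rel V) => _ _ _ _ /andP[/eqP]. Qed.
Lemma act_asp V : act_a V *m act_sp V = act_sp V *m act_a V.
Proof. by case/and5P: (act_rel V) => /eqP. Qed.
Lemma act_asm V : act_a V *m act_sm V = act_sm V *m act_a V.
Proof. by case/and5P: (act_rel V) => _ /eqP. Qed.
Lemma act_pow V : (act_sp V * act_sm V) ^+ m = act_a V.
Proof. by case/and5P: (act_rel V) => _ _ _ _ /andP[_ /eqP]. Qed.

Lemma act_pow' V : (act_sm V * act_sp V) ^+ m = act_a V.
Proof.
have H k : act_sm V * (act_sp V * act_sm V) ^+ k =
           (act_sm V * act_sp V) ^+ k * act_sm V.
  elim: k => [|k IH]; first by rewrite !expr0 mulr1 mul1r.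
  by rewrite [in LHS]exprSr mulrA IH [in RHS]exprSr !mulrA.
have := H m; rewrite act_pow => E.
have /(congr1 (mulmx^~ (act_sm V))) := E.
rewrite -[RHS]mulmxA act_smsm mulmx1 => <-.
by rewrite -[_ * act_a V]act_asm -mulmxA act_smsm mulmx1.
Qed.

Lemma half2 : (2^-1 + 2^-1 : F) = 1.
Proof. by rewrite -mulr2n -[LHS]mulr_natr mulVf // pnatr_eq0. Qed.

Lemma e01 V : act_e0 V + act_e1 V = 1%:M.
Proof.
rewrite -scalerDr addrACA subrr addr0 scalerDr -scalerDl half2.
exact: scale1r.
Qed.

Lemma e0a V : act_e0 V *m act_a V = act_e0 V.
Proof. by rewrite -scalemxAl mulmxDl act_aa mul1mx addrC. Qed.

Lemma e1a V : act_e1 V *m act_a V = - act_e1 V.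
Proof. by rewrite -scalemxAl mulmxBl act_aa mul1mx -scalerN opprB. Qed.

Lemma e0e0 V : act_e0 V *m act_e0 V = act_e0 V.
Proof.
rewrite [X in _ *m X]/act_e0 -scalemxAr mulmxDr mulmx1 e0a scalerDr -scalerDl half2.
exact: scale1r.
Qed.

Lemma e1e0 V : act_e1 V *m act_e0 V = 0.
Proof. by rewrite [X in _ *m X]/act_e0 -scalemxAr mulmxDr mulmx1 e1a subrr scaler0. Qed.

Lemma e0e1 V : act_e0 V *m act_e1 V = 0.
Proof. by rewrite [X in _ *m X]/act_e1 -scalemxAr mulmxBr mulmx1 e0a subrr scaler0. Qed.

Lemma e1e1 V : act_e1 V *m act_e1 V = act_e1 V.
Proof.
rewrite [X in _ *m X]/act_e1 -scalemxAr mulmxBr mulmx1 e1a opprK scalerDr -scalerDl half2.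
exact: scale1r.
Qed.

Lemma spe0 V : act_sp V *m act_e0 V = act_e0 V *m act_sp V.
Proof. by rewrite -scalemxAr -scalemxAl mulmxDl mulmxDr mul1mx mulmx1 act_asp. Qed.
Lemma spe1 V : act_sp V *m act_e1 V = act_e1 V *m act_sp V.
Proof. by rewrite -scalemxAr -scalemxAl mulmxBl mulmxBr mul1mx mulmx1 act_asp. Qed.
Lemma sme0 V : act_sm V *m act_e0 V = act_e0 V *m act_sm V.
Proof. by rewrite -scalemxAr -scalemxAl mulmxDl mulmxDr mul1mx mulmx1 act_asm. Qed.
Lemma sme1 V : act_sm V *m act_e1 V = act_e1 V *m act_sm V.
Proof. by rewrite -scalemxAr -scalemxAl mulmxBl mulmxBr mul1mx mulmx1 act_asm. Qed.

(* Tensor product: the actions are given by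
   Delta(s_+) = s_+ (x) e_0 s_+ + s_- (x) e_1 s_+,
   Delta(s_-) = s_- (x) e_0 s_- + s_+ (x) e_1 s_-, Delta(a) = a (x) a. *)
Section Tens.
Variables V W : bmod.

Definition tens_sp : 'M[F]_(dim V * dim W) :=
  tensmx (act_sp V) (act_e0 W *m act_sp W) +
  tensmx (act_sm V) (act_e1 W *m act_sp W).
Definition tens_sm : 'M[F]_(dim V * dim W) :=
  tensmx (act_sm V) (act_e0 W *m act_sm W) +
  tensmx (act_sp V) (act_e1 W *m act_sm W).
Definition tens_a : 'M[F]_(dim V * dim W) := tensmx (act_a V) (act_a W).

Lemma eXY0 (e e' X Y : 'M[F]_(dim W)) :
  X *m e' = e' *m X -> e *m e' = 0 -> (e *m X) *m (e' *m Y) = 0.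
Proof. by move=> c z; rewrite mulmxA -(mulmxA e) c mulmxA z !mul0mx. Qed.
Lemma eXYe (e X Y : 'M[F]_(dim W)) :
  X *m e = e *m X -> e *m e = e -> (e *m X) *m (e *m Y) = e *m (X *m Y).
Proof. by move=> c z; rewrite mulmxA -(mulmxA e) c !mulmxA z. Qed.

Lemma tens_rel : B4m_rel m tens_sp tens_sm tens_a.
Proof.
apply/and5P; split; last (apply/andP; split); apply/eqP.
- rewrite /tens_a /tens_sp -[_ * _]/(_ *m _) -[_ * tensmx _ _]/(_ *m _).
  rewrite mulmxDl mulmxDr !tensmx_mul !act_asp act_asm.
  rewrite -!mulmxA -!act_asp !mulmxA.
  rewrite -[act_e0 W *m act_a W](_ : act_a W *m act_e0 W = _) //; last first.
    by rewrite -scalemxAr -scalemxAl mulmxDl mulmxDr mul1mx mulmx1.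
  rewrite -[act_e1 W *m act_a W](_ : act_a W *m act_e1 W = _) //.
  by rewrite -scalemxAr -scalemxAl mulmxBl mulmxBr mul1mx mulmx1.
- rewrite /tens_a /tens_sm -[_ * _]/(_ *m _) -[_ * tensmx _ _]/(_ *m _).
  rewrite mulmxDl mulmxDr !tensmx_mul !act_asm act_asp.
  rewrite -!mulmxA -!act_asm !mulmxA.
  rewrite -[act_e0 W *m act_a W](_ : act_a W *m act_e0 W = _) //; last first.
    by rewrite -scalemxAr -scalemxAl mulmxDl mulmxDr mul1mx mulmx1.
  rewrite -[act_e1 W *m act_a W](_ : act_a W *m act_e1 W = _) //.
  by rewrite -scalemxAr -scalemxAl mulmxBl mulmxBr mul1mx mulmx1.
- by rewrite expr2 -[_ * _]/(_ *m _) tensmx_mul !act_aa tensmx11.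
- rewrite expr2 -[_ * _]/(_ *m _) mulmxDl !mulmxDr !tensmx_mul.
  rewrite !eXYe ?spe0 ?spe1 ?e0e0 ?e1e1 //.
  rewrite !eXY0 ?spe0 ?spe1 ?e0e1 ?e1e0 // !tensmx0 addr0 add0r.
  by rewrite !act_spsp !act_smsm -tensmxDr !mulmx1 e01 tensmx11.
- rewrite expr2 -[_ * _]/(_ *m _) mulmxDl !mulmxDr !tensmx_mul.
  rewrite !eXYe ?sme0 ?sme1 ?e0e0 ?e1e1 //.
  rewrite !eXY0 ?sme0 ?sme1 ?e0e1 ?e1e0 // !tensmx0 addr0 add0r.
  by rewrite !act_spsp !act_smsm -tensmxDr !mulmx1 e01 tensmx11.
- set P := tens_sp * tens_sm.
  set X := act_sp V * act_sm V; set X' := act_sm V * act_sp V.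
  set Y := act_sp W * act_sm W.
  have PE : P = tensmx X (act_e0 W *m Y) + tensmx X' (act_e1 W *m Y).
    rewrite /P -[_ * _]/(_ *m _) mulmxDl !mulmxDr !tensmx_mul.
    rewrite !eXYe ?spe0 ?spe1 ?e0e0 ?e1e1 //.
    by rewrite !eXY0 ?spe0 ?spe1 ?e0e1 ?e1e0 // !tensmx0 addr0 add0r.
  have c0 : Y *m act_e0 W = act_e0 W *m Y.
    by rewrite -[Y]/(_ *m _) -mulmxA sme0 !mulmxA spe0.
  have c1 : Y *m act_e1 W = act_e1 W *m Y.
    by rewrite -[Y]/(_ *m _) -mulmxA sme1 !mulmxA spe1.
  have PK k : P ^+ k = tensmx (X ^+ k) (act_e0 W *m Y ^+ k) +
                       tensmx (X' ^+ k) (act_e1 W *m Y ^+ k).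
    elim: k => [|k IH].
      by rewrite !expr0 -tensmxDr -[1]/(1%:M) !mulmx1 e01 tensmx11.
    rewrite exprS IH PE -[_ * _]/(_ *m _) mulmxDl !mulmxDr !tensmx_mul.
    rewrite !eXYe ?c0 ?c1 ?e0e0 ?e1e1 //.
    rewrite !eXY0 ?c0 ?c1 ?e0e1 ?e1e0 // !tensmx0 addr0 add0r.
    by rewrite !exprS.
  by rewrite PK /X /X' /Y !act_pow act_pow' -tensmxDr -mulmxDl e01 mul1mx.
Qed.

Definition tens : bmod := mk_bmod tens_rel.

Definition tensv (v : 'cV[F]_(dim V)) (w : 'cV[F]_(dim W)) :
  'cV[F]_(dim tens) := tensmx v w.

End Tens.

Section DirectSum.
Variables V W : bmod.

Lemma dsum_rel : B4m_rel m
  (block_mx (act_sp V) 0 0 (act_sp W))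
  (block_mx (act_sm V) 0 0 (act_sm W))
  (block_mx (act_a V) 0 0 (act_a W)).
Proof.
have M A B C D : block_mx A 0 0 B * block_mx C 0 0 D =
    block_mx (A *m C) 0 0 (B *m D) :> 'M[F]_(dim V + dim W).
  by rewrite -[LHS]/(_ *m _) mulmx_block !mulmx0 !mul0mx !addr0 !add0r.
have X k A B : block_mx A 0 0 B ^+ k = block_mx (A ^+ k) 0 0 (B ^+ k)
    :> 'M[F]_(dim V + dim W).
  by elim: k => [|k IH]; rewrite ?expr0 -?scalar_mx_block // !exprS IH M.
rewrite /B4m_rel !expr2 !M X !act_pow !act_asp !act_asm !act_aa !act_spsp.
by rewrite !act_smsm -scalar_mx_block !eqxx.
Qed.

Definition dsum : bmod := mk_bmod dsum_rel.

End DirectSum.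

Definition is_hom (V W : bmod) (f : 'M[F]_(dim W, dim V)) : Prop :=
  [/\ f *m act_sp V = act_sp W *m f, f *m act_sm V = act_sm W *m f
    & f *m act_a V = act_a W *m f].

Definition is_iso (V W : bmod) (f : 'M[F]_(dim W, dim V)) : Prop :=
  is_hom f /\ exists g, f *m g = 1%:M /\ g *m f = 1%:M.

(* 0 -> U -> V -> W -> 0 *)
Definition ses (U V W : bmod) : Prop :=
  exists (f : 'M[F]_(dim V, dim U)) (g : 'M[F]_(dim W, dim V)),
    [/\ is_hom f, is_hom g,
        forall u : 'cV_(dim U), f *m u = 0 -> u = 0,
        forall w : 'cV_(dim W), exists v, g *m v = w &
        forall v : 'cV_(dim V), g *m v = 0 <-> exists u, v = f *m u].

(* The subgroup of the free abelian group on the modules generated by the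
   V - U - W, for 0 -> U -> V -> W -> 0 exact. *)
Inductive K0rel : {freeg bmod / int} -> Prop :=
| K0rel0 : K0rel 0
| K0relB x y : K0rel x -> K0rel y -> K0rel (x - y)
| K0rel_ses U V W : ses U V W -> K0rel (<< V >> - << U >> - << W >>).

Definition in_K0rel (x : {freeg bmod / int}) : bool := `[< K0rel x >].


(* The modules form a strict monoid under the tensor product. *)
Lemma mk_bmod_cast n n' (e : n = n') (sp sm a : 'M[F]_n) (sp' sm' a' : 'M[F]_n')
    (h : B4m_rel m sp sm a) (h' : B4m_rel m sp' sm' a') :
  castmx (e, e) sp = sp' -> castmx (e, e) sm = sm' -> castmx (e, e) a = a' ->
  mk_bmod h = mk_bmod h'.
Proof.
case: n' / e sp' sm' a' h' => sp' sm' a' h'; rewrite !castmx_id => e1 e2 e3.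
by apply: val_inj; rewrite /= e1 e2 e3.
Qed.

Lemma castmx_entry n p n' p' (en : n = n') (ep : p = p') (A : 'M[F]_(n, p))
    (B : 'M[F]_(n', p')) :
  (forall i j i' j', val i = val i' -> val j = val j' -> A i j = B i' j') ->
  castmx (en, ep) A = B.
Proof.
move=> AB; apply/matrixP => i j; rewrite castmxE; apply: AB => //=.
Qed.

Lemma tensmxA n1 p1 n2 p2 n3 p3 (A : 'M[F]_(n1, p1)) (B : 'M[F]_(n2, p2))
    (C : 'M[F]_(n3, p3)) :
  castmx (mulnA _ _ _, mulnA _ _ _) (tensmx A (tensmx B C)) =
  tensmx (tensmx A B) C.
Proof.
apply: castmx_entry => i j i' j' ei ej; rewrite !mxE !mulrA.
have d1 x b c : (x %/ (b * c) = x %/ c %/ b)%N by rewrite mulnC divnMA.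
have d2 x b c : (x %% (b * c) %/ c = x %/ c %% b)%N by rewrite modn_divl.
have d3 x b c : (x %% (b * c) %% c = x %% c)%N.
  by rewrite modn_dvdm // dvdn_mull.
have {}ei : (i = i' :> nat) by []; have {}ej : (j = j' :> nat) by [].
congr (A _ _ * B _ _ * C _ _); apply: val_inj => /=.
all: by rewrite ?ei ?ej ?d1 ?d2 ?d3.
Qed.

Lemma castmxD n n' (e : n = n') (A B : 'M[F]_n) :
  castmx (e, e) (A + B) = castmx (e, e) A + castmx (e, e) B.
Proof. by case: n' / e; rewrite !castmx_id. Qed.

Lemma act_aE V : act_a V = act_e0 V - act_e1 V.
Proof.
rewrite -scalerBr opprB [X in _ *: X]addrC addrA subrK scalerDr -scalerDl half2.
by rewrite scale1r.
Qed.

Lemma tensmxNl n1 p1 n2 p2 (A : 'M[F]_(n1, p1)) (B : 'M[F]_(n2, p2)) :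
  tensmx (- A) B = - tensmx A B.
Proof. by apply/matrixP => i j; rewrite !mxE mulNr. Qed.
Lemma tensmxNr n1 p1 n2 p2 (A : 'M[F]_(n1, p1)) (B : 'M[F]_(n2, p2)) :
  tensmx A (- B) = - tensmx A B.
Proof. by apply/matrixP => i j; rewrite !mxE mulrN. Qed.

Lemma e0_tens V W : act_e0 (tens V W) =
  tensmx (act_e0 V) (act_e0 W) + tensmx (act_e1 V) (act_e1 W) :> 'M_(dim V * dim W).
Proof.
rewrite [LHS]/act_e0 -[act_a (tens V W)]/(tens_a V W).
have -> : 1%:M = tensmx (act_e0 V + act_e1 V) (act_e0 W + act_e1 W).
  by rewrite !e01 tensmx11.
rewrite /tens_a !act_aE.
set x := act_e0 V; set y := act_e1 V; set z := act_e0 W; set t := act_e1 W.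
rewrite !(tensmxDl, tensmxDr, tensmxNl, tensmxNr) opprK.
set p := tensmx x z; set q := tensmx x t; set r := tensmx y z; set s := tensmx y t.
have -> : p + q + (r + s) + (p - q + (- r + s)) = (p + s) + (p + s).
  by apply/matrixP => i j; rewrite !mxE; ring.
by rewrite scalerDr -scalerDl half2 scale1r.
Qed.

Lemma e1_tens V W : act_e1 (tens V W) =
  tensmx (act_e0 V) (act_e1 W) + tensmx (act_e1 V) (act_e0 W) :> 'M_(dim V * dim W).
Proof.
have := e01 (tens V W); rewrite e0_tens => /(canRL (addKr _)) ->.
have -> : 1%:M = tensmx (act_e0 V + act_e1 V) (act_e0 W + act_e1 W).
  by rewrite !e01 tensmx11.
rewrite !(tensmxDl, tensmxDr).
set p := tensmx _ _; set q := tensmx _ _; set r := tensmx _ _; set s := tensmx _ _.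
by apply/matrixP => i j; rewrite !mxE; ring.
Qed.

Definition e_simpl V := (e0e0 V, e0e1 V, e1e0 V, e1e1 V).

Lemma e0_tens_sp V W : act_e0 (tens V W) *m act_sp (tens V W) =
  tensmx (act_e0 V *m act_sp V) (act_e0 W *m act_sp W) +
  tensmx (act_e1 V *m act_sm V) (act_e1 W *m act_sp W) :> 'M_(dim V * dim W).
Proof.
rewrite e0_tens -[act_sp (tens V W)]/(tens_sp V W) /tens_sp.
rewrite !(mulmxDl, mulmxDr) !tensmx_mul !mulmxA !e_simpl !mul0mx !tensmx0.
by rewrite addr0 add0r.
Qed.

Lemma e1_tens_sp V W : act_e1 (tens V W) *m act_sp (tens V W) =
  tensmx (act_e1 V *m act_sp V) (act_e0 W *m act_sp W) +
  tensmx (act_e0 V *m act_sm V) (act_e1 W *m act_sp W) :> 'M_(dim V * dim W).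
Proof.
rewrite e1_tens -[act_sp (tens V W)]/(tens_sp V W) /tens_sp.
rewrite !(mulmxDl, mulmxDr) !tensmx_mul !mulmxA !e_simpl !mul0mx !tensmx0.
by rewrite addr0 add0r addrC.
Qed.

Lemma e0_tens_sm V W : act_e0 (tens V W) *m act_sm (tens V W) =
  tensmx (act_e0 V *m act_sm V) (act_e0 W *m act_sm W) +
  tensmx (act_e1 V *m act_sp V) (act_e1 W *m act_sm W) :> 'M_(dim V * dim W).
Proof.
rewrite e0_tens -[act_sm (tens V W)]/(tens_sm V W) /tens_sm.
rewrite !(mulmxDl, mulmxDr) !tensmx_mul !mulmxA !e_simpl !mul0mx !tensmx0.
by rewrite addr0 add0r.
Qed.

Lemma e1_tens_sm V W : act_e1 (tens V W) *m act_sm (tens V W) =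
  tensmx (act_e1 V *m act_sm V) (act_e0 W *m act_sm W) +
  tensmx (act_e0 V *m act_sp V) (act_e1 W *m act_sm W) :> 'M_(dim V * dim W).
Proof.
rewrite e1_tens -[act_sm (tens V W)]/(tens_sm V W) /tens_sm.
rewrite !(mulmxDl, mulmxDr) !tensmx_mul !mulmxA !e_simpl !mul0mx !tensmx0.
by rewrite addr0 add0r addrC.
Qed.

Lemma tensA U V W : tens U (tens V W) = tens (tens U V) W.
Proof.
apply: (mk_bmod_cast (e := mulnA _ _ _)); last exact: tensmxA.
- rewrite {1}/tens_sp e0_tens_sp e1_tens_sp.
  rewrite {1}/tens_sp -[act_sp (tens U V)]/(tens_sp U V).
  rewrite -[act_sm (tens U V)]/(tens_sm U V) {1}/tens_sp /tens_sm.
  rewrite !(tensmxDl, tensmxDr) !castmxD !tensmxA.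
  by rewrite addrACA [X in _ + X]addrC.
- rewrite {1}/tens_sm e0_tens_sm e1_tens_sm.
  rewrite {1}/tens_sm -[act_sp (tens U V)]/(tens_sp U V).
  rewrite -[act_sm (tens U V)]/(tens_sm U V) {1}/tens_sm /tens_sp.
  rewrite !(tensmxDl, tensmxDr) !castmxD !tensmxA.
  by rewrite addrACA [X in _ + X]addrC.
Qed.

Definition T_ok (c1 c2 c3 : F) : bool :=
  [&& c1 ^+ 2 == 1, c2 ^+ 2 == 1, c3 ^+ 2 == 1 & (c1 * c2) ^+ m == c3].

Lemma T_rel c1 c2 c3 : T_ok c1 c2 c3 ->
  B4m_rel m (c1%:M : 'M[F]_1) (c2%:M) (c3%:M).
Proof.
move=> /and4P[/eqP h1 /eqP h2 /eqP h3 /eqP h4].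
have M (x y : F) : x%:M * y%:M = (x * y)%:M :> 'M_1 
    by rewrite -[LHS]/(_ *m _) -scalar_mxM.
have X (x : F) k : x%:M ^+ k = (x ^+ k)%:M :> 'M_1.
  by elim: k => // k IH; rewrite !exprS IH M.
by rewrite /B4m_rel !M !X h1 h2 h3 h4 (mulrC c3) (mulrC c3) !eqxx.
Qed.

Definition Tmod c1 c2 c3 (h : T_ok c1 c2 c3) : bmod := mk_bmod (T_rel h).

Lemma T_ok_triv : T_ok 1 1 1.
Proof. by rewrite /T_ok !mul1r !expr1n !eqxx. Qed.

(* The trivial module, given by the counit. *)
Definition triv : bmod := Tmod T_ok_triv.

Lemma act_e0_triv : act_e0 triv = 1%:M.
Proof.
by rewrite /act_e0 -[act_a triv]/(1%:M) scalerDr -scalerDl half2 scale1r.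
Qed.

Lemma act_e1_triv : act_e1 triv = 0.
Proof. by rewrite /act_e1 -[act_a triv]/(1%:M) subrr scaler0. Qed.

Lemma mk_bmodK V : mk_bmod (act_rel V) = V.
Proof. by case: V => -[n [[sp sm] a]] h; apply: val_inj. Qed.

Lemma tens1m V : tens triv V = V.
Proof.
rewrite -[RHS]mk_bmodK; apply: (mk_bmod_cast (e := mul1n _)).
- rewrite /tens_sp -tensmxDr -mulmxDl e01 mul1mx.
  by rewrite tens_scalar1mx castmx_comp castmx_id.
- rewrite /tens_sm -tensmxDr -mulmxDl e01 mul1mx.
  by rewrite tens_scalar1mx castmx_comp castmx_id.
- by rewrite /tens_a tens_scalar1mx castmx_comp castmx_id.
Qed.

Lemma tensm1 V : tens V triv = V.
Proof.
rewrite -[RHS]mk_bmodK; apply: (mk_bmod_cast (e := muln1 _)).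
- rewrite /tens_sp act_e0_triv act_e1_triv mul1mx mul0mx tensmx0 addr0.
  by rewrite tens_mx_scalar scale1r castmx_comp castmx_id.
- rewrite /tens_sm act_e0_triv act_e1_triv mul1mx mul0mx tensmx0 addr0.
  by rewrite tens_mx_scalar scale1r castmx_comp castmx_id.
- by rewrite /tens_a tens_mx_scalar scale1r castmx_comp castmx_id.
Qed.

Lemma lift_cols n p k (f : 'M[F]_(n, p)) (x : 'M[F]_(n, k)) :
  (forall i, exists u : 'cV_p, col i x = f *m u) -> exists r, x = f *m r.
Proof.
move=> /fin_all_exists[u ux]; exists (\matrix_(i, j) u j i 0).
apply/matrixP => i j; have /matrixP/(_ i 0) := ux j; rewrite !mxE => ->.
by apply: eq_bigr => l _; rewrite !mxE.
Qed.

Lemma ses_split U V W : ses U V W ->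
  exists (f : 'M_(dim V, dim U)) (g : 'M_(dim W, dim V)) r s,
  [/\ is_hom f, is_hom g, r *m f = 1%:M, g *m s = 1%:M & g *m f = 0
      /\ f *m r + s *m g = 1%:M].
Proof.
move=> [f [g [hf hg fi gs ex]]].
have gf : g *m f = 0.
  apply/matrixP => i j; have /colP/(_ i) : g *m (f *m (delta_mx j 0 : 'cV_(dim U))) = 0.
    by apply/ex; exists (delta_mx j 0).
  by rewrite mulmxA -colE !mxE.
have [s gs1] : exists s, 1%:M = g *m s.
  by apply: lift_cols => i; case: (gs (col i 1%:M)) => v <-; exists v.
have [r fr] : exists r, 1%:M - s *m g = f *m r.
  apply: lift_cols => i; apply/ex.
  by rewrite colE !mulmxA mulmxBr mulmx1 mulmxA -gs1 mul1mx subrr mul0mx.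
exists f, g, r, s; split=> //; last by split; rewrite // -fr subrK.
apply/eqP; rewrite -subr_eq0; apply/eqP/matrixP => i j.
have /colP/(_ i) : (r *m f - 1%:M) *m (delta_mx j 0 : 'cV_(dim U)) = 0.
  apply: fi; rewrite mulmxA; set z := f *m _.
  have -> : z = 0; last exact: mul0mx.
  rewrite /z mulmxBr mulmx1 mulmxA -fr mulmxBl mul1mx.
  by rewrite -mulmxA gf mulmx0 subr0 subrr.
by rewrite -colE !mxE.
Qed.

Lemma ses_of_split U V W (f : 'M_(dim V, dim U)) (g : 'M_(dim W, dim V)) r s :
  is_hom f -> is_hom g -> r *m f = 1%:M -> g *m s = 1%:M -> g *m f = 0 ->
  f *m r + s *m g = 1%:M -> ses U V W.
Proof.
move=> hf hg rf gs gf e; exists f, g; split=> //.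
- by move=> u /(congr1 (mulmx r)); rewrite mulmxA rf mul1mx mulmx0.
- by move=> w; exists (s *m w); rewrite mulmxA gs mul1mx.
- move=> v; split=> [gv|[u ->]]; last by rewrite mulmxA gf mul0mx.
  exists (r *m v); rewrite -[LHS]mul1mx -e mulmxDl -[s *m g *m v]mulmxA gv.
  by rewrite mulmx0 addr0 mulmxA.
Qed.

Lemma hom_e0 V W (f : 'M_(dim W, dim V)) : is_hom f ->
  f *m act_e0 V = act_e0 W *m f.
Proof.
by case=> _ _ h; rewrite -scalemxAr -scalemxAl mulmxDl mulmxDr mul1mx mulmx1 h.
Qed.
Lemma hom_e1 V W (f : 'M_(dim W, dim V)) : is_hom f ->
  f *m act_e1 V = act_e1 W *m f.
Proof.
by case=> _ _ h; rewrite -scalemxAr -scalemxAl mulmxBl mulmxBr mul1mx mulmx1 h.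
Qed.

Lemma hom_tens V V' W W' (f : 'M_(dim V', dim V)) (g : 'M_(dim W', dim W)) :
  is_hom f -> is_hom g -> @is_hom (tens V W) (tens V' W') (tensmx f g).
Proof.
move=> hf hg; have [f1 f2 f3] := hf; have [g1 g2 g3] := hg.
split.
- rewrite -[act_sp (tens _ _)]/(tens_sp V W) -[act_sp (tens _ _)]/(tens_sp V' W').
  rewrite mulmxDl mulmxDr !tensmx_mul f1 f2 !mulmxA (hom_e0 hg) (hom_e1 hg).
  by rewrite -!mulmxA g1.
- rewrite -[act_sm (tens _ _)]/(tens_sm V W) -[act_sm (tens _ _)]/(tens_sm V' W').
  rewrite mulmxDl mulmxDr !tensmx_mul f1 f2 !mulmxA (hom_e0 hg) (hom_e1 hg).
  by rewrite -!mulmxA g2.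
- rewrite -[act_a (tens _ _)]/(tens_a V W) -[act_a (tens _ _)]/(tens_a V' W').
  by rewrite !tensmx_mul f3 g3.
Qed.

Lemma hom1 V : @is_hom V V 1%:M.
Proof. by split; rewrite mul1mx mulmx1. Qed.

Lemma ses_tensl X U V W : ses U V W -> ses (tens X U) (tens X V) (tens X W).
Proof.
move=> /ses_split[f [g [r [s [hf hg rf gs [gf e]]]]]].
apply: (@ses_of_split (tens X U) (tens X V) (tens X W) (tensmx 1%:M f)
  (tensmx 1%:M g) (tensmx 1%:M r) (tensmx 1%:M s)).
- exact/hom_tens/hf/hom1.
- exact/hom_tens/hg/hom1.
- by rewrite tensmx_mul rf mul1mx tensmx11.
- by rewrite tensmx_mul gs mul1mx tensmx11.
- by rewrite tensmx_mul gf tensmx0.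
- by rewrite !tensmx_mul mul1mx -tensmxDr e tensmx11.
Qed.

Lemma ses_tensr X U V W : ses U V W -> ses (tens U X) (tens V X) (tens W X).
Proof.
move=> /ses_split[f [g [r [s [hf hg rf gs [gf e]]]]]].
apply: (@ses_of_split (tens U X) (tens V X) (tens W X) (tensmx f 1%:M)
  (tensmx g 1%:M) (tensmx r 1%:M) (tensmx s 1%:M)).
- exact/hom_tens/hom1/hf.
- exact/hom_tens/hom1/hg.
- by rewrite tensmx_mul rf mul1mx tensmx11.
- by rewrite tensmx_mul gs mul1mx tensmx11.
- by rewrite tensmx_mul gf tens0mx.
- by rewrite !tensmx_mul mul1mx -tensmxDl e tensmx11.
Qed.

(* The product of the free abelian group on the modules that extends the
   tensor product bilinearly. *)
Definition fgmul (x y : {freeg bmod / int}) : {freeg bmod / int} :=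
  fglift (fun V => fglift (fun W => << tens V W >>) y) x.

Lemma fgmulBl : left_distributive fgmul (fun x y => x - y).
Proof. by move=> x y z; rewrite /fgmul lift_is_additive. Qed.

Lemma fgU k (V : bmod) : << k *g V >> = << V >> *~ k :> {freeg bmod / int}.
Proof. by rewrite freegU_mulz intz. Qed.

Lemma fg_ind (P : {freeg bmod / int} -> Prop) :
  P 0 -> (forall x y, P x -> P y -> P (x - y)) -> (forall V, P << V >>) ->
  forall x, P x.
Proof.
move=> P0 PB PU x.
have PN y : P y -> P (- y) by rewrite -sub0r; exact: PB.
have PD y z : P y -> P z -> P (y + z) by move=> ? ?; rewrite -[z]opprK; exact/PB/PN.
have Pn y n : P y -> P (y *+ n) by move=> h; elim: n => // n IH; rewrite mulrS; exact: PD.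
elim/freeg_ind_dom0: x => // k V D _ _ PDD; apply: PD => //.
by rewrite fgU; case: k => n; [exact/Pn | rewrite NegzE mulrNz; exact/PN/Pn].
Qed.

Lemma fgmulUU V W : fgmul << V >> << W >> = << tens V W >>.
Proof. by rewrite /fgmul !liftU !scale1r. Qed.

Lemma fgmul0l y : fgmul 0 y = 0.
Proof. by have := fgmulBl 0 0 y; rewrite !subrr. Qed.

Lemma fgmulBr : right_distributive fgmul (fun x y => x - y).
Proof.
move=> x y z; elim/fg_ind: x => [|u v IHu IHv|V].
- by rewrite !fgmul0l subrr.
- by rewrite !fgmulBl IHu IHv !opprD !opprK addrACA.
- by rewrite /fgmul !liftU !scale1r lift_is_additive.
Qed.

Lemma fgmul0r y : fgmul y 0 = 0.
Proof. by have := fgmulBr y 0 0; rewrite !subrr. Qed.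

Lemma fgmulA : associative fgmul.
Proof.
move=> x y z; elim/fg_ind: x => [|u v IHu IHv|U].
- by rewrite !fgmul0l.
- by rewrite !fgmulBl IHu IHv.
elim/fg_ind: y => [|u v IHu IHv|V].
- by rewrite fgmul0r !fgmul0l fgmul0r.
- by rewrite !(fgmulBl, fgmulBr) IHu IHv.
elim/fg_ind: z => [|u v IHu IHv|W].
- by rewrite !fgmul0r.
- by rewrite !fgmulBr IHu IHv.
by rewrite !fgmulUU tensA.
Qed.

Lemma fgmul1l x : fgmul << triv >> x = x.
Proof.
elim/fg_ind: x => [|u v IHu IHv|U]; first by rewrite fgmul0r.
- by rewrite fgmulBr IHu IHv.
- by rewrite fgmulUU tens1m.
Qed.

Lemma fgmul1r x : fgmul x << triv >> = x.
Proof.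
elim/fg_ind: x => [|u v IHu IHv|U]; first by rewrite fgmul0l.
- by rewrite fgmulBl IHu IHv.
- by rewrite fgmulUU tensm1.
Qed.

Lemma in_K0relP x : reflect (K0rel x) (x \in in_K0rel).
Proof. exact: asboolP. Qed.

Lemma in_K0rel_closed : zmod_closed in_K0rel.
Proof.
split; first exact/in_K0relP/K0rel0.
by move=> x y /in_K0relP xI /in_K0relP yI; apply/in_K0relP/K0relB.
Qed.
HB.instance Definition _ := GRing.isZmodClosed.Build {freeg bmod / int} in_K0rel
  in_K0rel_closed.

Lemma in_K0relMl x y : y \in in_K0rel -> fgmul x y \in in_K0rel.
Proof.
move=> /in_K0relP; elim=> [|u v _ IHu _ IHv|U V W s].
- by rewrite fgmul0r rpred0.
- by rewrite fgmulBr rpredB.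
elim/fg_ind: x => [|u v IHu IHv|X]; first by rewrite fgmul0l rpred0.
- by rewrite fgmulBl rpredB.
- by rewrite !fgmulBr !fgmulUU; exact/in_K0relP/K0rel_ses/ses_tensl.
Qed.

Lemma in_K0relMr x y : x \in in_K0rel -> fgmul x y \in in_K0rel.
Proof.
move=> /in_K0relP; elim=> [|u v _ IHu _ IHv|U V W s].
- by rewrite fgmul0l rpred0.
- by rewrite fgmulBl rpredB.
elim/fg_ind: y => [|u v IHu IHv|X]; first by rewrite fgmul0r rpred0.
- by rewrite fgmulBr rpredB.
- by rewrite !fgmulBl !fgmulUU; exact/in_K0relP/K0rel_ses/ses_tensr.
Qed.

(* The Grothendieck ring of finite-dimensional B_{4m}-modules. *)
Definition K0 := Quotient.quot (GRing.ZmodClosed.clone _ in_K0rel _).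
HB.instance Definition _ := GRing.Zmodule.on K0.
HB.instance Definition _ := EqQuotient.on K0.

Definition cls (V : bmod) : K0 := \pi_K0 << V >>.

Definition K0_one : K0 := cls triv.
Definition K0_mul : K0 -> K0 -> K0 := lift_op2 K0 fgmul.

Lemma pi_K0_mul : {morph \pi_K0 : x y / fgmul x y >-> K0_mul x y}.
Proof.
move=> x y; unlock K0_mul; apply/eqP; rewrite -Quotient.idealrBE.
set x' := repr _; set y' := repr _.
have xI : x - x' \in in_K0rel by rewrite Quotient.idealrBE reprK.
have yI : y - y' \in in_K0rel by rewrite Quotient.idealrBE reprK.
have -> : fgmul x y - fgmul x' y' = fgmul (x - x') y + fgmul x' (y - y').
  by rewrite fgmulBl fgmulBr addrA subrK.
by apply: rpredD; [exact: in_K0relMr | exact: in_K0relMl].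
Qed.

Lemma pi_K0B : {morph \pi_K0 : x y / x - y >-> x - y}.
Proof. exact: raddfB. Qed.

Lemma K0_mulA : associative K0_mul.
Proof.
move=> x y z; rewrite -[x]reprK -[y]reprK -[z]reprK.
by rewrite -!pi_K0_mul fgmulA.
Qed.

Lemma K0_mul1l : left_id K0_one K0_mul.
Proof. by move=> x; rewrite -[x]reprK -pi_K0_mul fgmul1l. Qed.

Lemma K0_mul1r : right_id K0_one K0_mul.
Proof. by move=> x; rewrite -[x]reprK -pi_K0_mul fgmul1r. Qed.

Lemma K0_mulDl : left_distributive K0_mul +%R.
Proof.
move=> x y z; rewrite -[x]reprK -[y]reprK -[z]reprK.
rewrite -!pi_K0_mul -!raddfD -pi_K0_mul; congr (\pi _).
by have := fgmulBl (repr x) (- repr y) (repr z); rewrite opprK => ->;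
  rewrite -sub0r fgmulBl fgmul0l sub0r opprK.
Qed.

Lemma K0_mulDr : right_distributive K0_mul +%R.
Proof.
move=> x y z; rewrite -[x]reprK -[y]reprK -[z]reprK.
rewrite -!pi_K0_mul -!raddfD -pi_K0_mul; congr (\pi _).
by have := fgmulBr (repr x) (repr y) (- repr z); rewrite opprK => ->;
  rewrite -[- repr z]sub0r fgmulBr fgmul0r sub0r opprK.
Qed.

HB.instance Definition _ := GRing.Zmodule_isPzRing.Build K0
  K0_mulA K0_mul1l K0_mul1r K0_mulDl K0_mulDr.

Lemma clsM V W : cls (tens V W) = cls V * cls W.
Proof. by rewrite -[RHS]pi_K0_mul fgmulUU. Qed.

Lemma cls_ses U V W : ses U V W -> cls V = cls U + cls W.
Proof.
move=> s; apply/eqP; rewrite -raddfD -Quotient.idealrBE opprD addrA.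
exact/in_K0relP/K0rel_ses.
Qed.

End Modules.

Arguments Tmod {F m} c1 c2 c3 h.

Section Fusion.
Variables (F : numFieldType) (m : nat) (V W : bmod F m).

(* V (x) W = U(b): the columns of b are the basis of V (x) W corresponding to
   the standard basis of U; fusion2 is the same for V (x) W = U1(b1) + U2(b2).
   In both cases the equality in the Grothendieck ring is stated as well. *)
Definition fusion1 (U : bmod F m) (b : 'M[F]_(dim (tens V W), dim U)) : Prop :=
  cls V * cls W = cls U /\ @is_iso F m U (tens V W) b.

Definition fusion2 (U1 : bmod F m) (b1 : 'M[F]_(dim (tens V W), dim U1))
    (U2 : bmod F m) (b2 : 'M[F]_(dim (tens V W), dim U2)) : Prop :=
  cls V * cls W = cls U1 + cls U2 /\
  @is_iso F m (dsum U1 U2) (tens V W) (row_mx b1 b2).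

End Fusion.

Definition basis2 (F : numFieldType) n (p q : 'cV[F]_n) : 'M[F]_(n, 2) :=
  row_mx p q.

Definition mx2 (F : numFieldType) (a b c d : F) : 'M[F]_2 :=
  \matrix_(i, j) if i == 0 then (if j == 0 then a else b)
                 else (if j == 0 then c else d).

Lemma mx2M (F : numFieldType) (a b c d a' b' c' d' : F) :
  mx2 a b c d * mx2 a' b' c' d' =
  mx2 (a * a' + b * c') (a * b' + b * d') (c * a' + d * c') (c * b' + d * d').
Proof.
apply/matrixP => i j; rewrite !mxE !big_ord_recl big_ord0 !mxE addr0 /=.
by case: ifP => _; case: ifP.
Qed.

Lemma mx2_diag (F : numFieldType) (a : F) : a%:M = mx2 a 0 0 a.
Proof. by apply/matrixP => -[[|[|//]] ?] -[[|[|//]] ?]; rewrite !mxE. Qed.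

Lemma mx2X (F : numFieldType) (a d : F) k :
  mx2 a 0 0 d ^+ k = mx2 (a ^+ k) 0 0 (d ^+ k).
Proof.
elim: k => [|k IH]; first by rewrite !expr0 -mx2_diag.
by rewrite !exprS IH mx2M !(mul0r, mulr0, add0r, addr0).
Qed.

Section ComplexModules.
Variables (R : realType) (m : nat).
Local Notation C := R[i].

(* exp (pi i / m) *)
Definition lambda : C :=
  Complex (cos (pi / m%:R)) (sin (pi / m%:R)).

Lemma deMoivre (x : R) n :
  (Complex (cos x) (sin x) : C) ^+ n = Complex (cos (x *+ n)) (sin (x *+ n)).
Proof.
elim: n => [|n IH]; first by rewrite expr0 mulr0n cos0 sin0.
rewrite exprS IH mulrS cosD sinD; congr Complex.
by rewrite addrC [X in X + _]mulrC.
Qed.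

Lemma lambda_neq0 : lambda != 0.
Proof.
apply/eqP => -[c s]; have := cos2Dsin2 (pi / m%:R : R).
by rewrite c s expr0n addr0 => /eqP; rewrite eq_sym oner_eq0.
Qed.

Hypothesis hm : (1 < m)%N.

Lemma lambda_m : lambda ^+ m = -1.
Proof.
rewrite deMoivre -[_ *+ m]mulr_natr divfK ?pnatr_eq0 -?lt0n ?(ltnW hm) //.
by rewrite cospi sinpi; apply/eqP; rewrite eq_complex /= oppr0 !eqxx.
Qed.

Lemma pi_rel (i : nat) :
  B4m_rel m (mx2 0 1 1 0) (mx2 0 (lambda ^- i) (lambda ^+ i) 0)
    ((-1) ^+ i)%:M.
Proof.
have l0 : lambda ^+ i != 0 by rewrite expf_neq0 ?lambda_neq0.
have li : (lambda ^+ i) ^+ m = (-1) ^+ i by rewrite exprAC lambda_m.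
rewrite /B4m_rel !expr2 !mx2_diag !mx2M !(mul0r, mulr0, add0r, addr0, mulr1, mul1r).
rewrite mulVf // mulfV // mx2X exprVn li -expr2 sqrr_sign invr_sign.
rewrite [lambda ^- i * _]mulrC [lambda ^+ i * (-1) ^+ i]mulrC.
have e1 : mx2 1 0 0 1 = 1 :> 'M[C]_2 by rewrite -mx2_diag.
by rewrite e1 !eqxx.
Qed.

Definition pimod (i : nat) : bmod C m := mk_bmod (pi_rel i).

(* The basis (u, v) of pi_i(u, v). *)
Definition pi_u (i : nat) : 'cV[C]_(dim (pimod i)) := (delta_mx 0 0 : 'cV_2).
Definition pi_v (i : nat) : 'cV[C]_(dim (pimod i)) := (delta_mx 1 0 : 'cV_2).

End ComplexModules.

Section OneDim.
Variables (F : numFieldType) (m : nat).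

Definition T_t (c1 c2 c3 : F) (h : T_ok m c1 c2 c3) : 'cV[F]_(dim (Tmod c1 c2 c3 h)) :=
  (delta_mx 0 0 : 'cV_1).

Definition is_sign (d : F) : bool := d \in [:: 1; -1].

Lemma is_signP d : is_sign d -> d ^+ 2 = 1.
Proof. by rewrite /is_sign !inE => /orP[]/eqP->; rewrite ?sqrrN expr1n. Qed.

Lemma is_signM d e : is_sign d -> is_sign e -> is_sign (d * e).
Proof.
rewrite /is_sign !inE => /orP[]/eqP-> /orP[]/eqP->;
  by rewrite ?(mulr1, mulrN1, opprK) eqxx ?orbT.
Qed.

Lemma T_ok_same d : is_sign d -> T_ok m d d 1.
Proof. by move=> /is_signP h; rewrite /T_ok -expr2 h !expr1n !eqxx. Qed.

Lemma T_ok_opp d : is_sign d -> T_ok m d (- d) ((-1) ^+ m).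
Proof.
by move=> /is_signP h; rewrite /T_ok mulrN -expr2 sqrrN h sqrr_sign !eqxx.
Qed.

End OneDim.

(* Main.v *)
Require Import Defs.
From mathcomp Require Import all_boot all_order all_algebra.
From mathcomp Require Import mxtens complex.
From mathcomp Require Import reals zify.

Set Implicit Arguments.
Unset Strict Implicit.
Unset Printing Implicit Defensive.

Import Order.TTheory GRing.Theory Num.Theory.

Local Open Scope ring_scope.

(** In any B_{4m}-module the product s_+ s_- acts invertibly, and s_+ conjugates
    it to its inverse s_- s_+.  So if p is an eigenvector of s_+ s_- for the
    eigenvalue z, then q = s_+ p is one for z^-1, and the whole module structure
    on the span of p and q is dictated by z: s_+ exchanges p and q, s_- p = z q,
    and a = (s_+ s_-)^m acts as the scalar z^m = z^-m.  In pi_k the pair (u, v)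
    has z = lambda^k, and in T_{c1,c2,c3} the pair (t, c1 t) has z = c1 c2; and
    exchanging p and q replaces z by z^-1.  Such a pair is called a
    weight pair here, and decomposing a module into modules pi_k amounts to
    finding weight pairs in it, whose eigenvalues are the lambda^k, and which
    together form a basis.

    On V (x) W, where a acts on w in W by 1 or -1, the coproduct lets s_+ and
    s_- act on v (x) w factor by factor in the first case, and with the two
    exchanged on the first factor in the second case.  So weight pairs with
    eigenvalues z and w tensor to a weight pair with eigenvalue z w when
    w^m = 1, and z^-1 w when w^m = -1 ([wp_tens_even], [wp_tens_odd]).  Every
    basis in the theorem arises in this way, with an exchange of the two vectors
    of a pair where its eigenvalue has to be inverted; the case distinctions on i and j
    only choose, among z and z^-1, the power of lambda whose exponent lies
    between 0 and m, with lambda^m = -1.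

    Linear independence is recorded along the way by a resolution of the
    identity: each vector p comes with a matrix E = p p' for some row vector p'.
    These matrices multiply under tensor products and are insensitive to
    rescaling p, and when they sum to 1, as many vectors p as the dimension form
    a basis.  The equality in the Grothendieck ring then follows from the isomorphism. *)

Local Notation dim := Defs.dim.

(** * Isomorphic modules have the same class *)

Section Homomorphisms.
Variables (F : numFieldType) (m : nat).

(** Since a = (s_+ s_-)^m, commuting with the action of s_+ and s_- suffices. *)
Lemma hom_gens (V W : bmod F m) (f : 'M[F]_(dim W, dim V)) :
  f *m act_sp V = act_sp W *m f -> f *m act_sm V = act_sm W *m f -> is_hom f.
Proof.
move=> fp fm; split=> //; rewrite -!act_pow.
have fX k : f *m (act_sp V * act_sm V) ^+ k = (act_sp W * act_sm W) ^+ k *m f.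
  elim: k => [|k IH]; first by rewrite !expr0 mulmx1 mul1mx.
  rewrite !exprS -![_ * _]/(_ *m _) !mulmxA fp -[_ *m f *m _]mulmxA fm.
  by rewrite !mulmxA -[LHS]mulmxA IH -!mulmxA.
exact: fX.
Qed.

Lemma zero_rel : B4m_rel m (0 : 'M[F]_0) 0 0.
Proof.
have e (A B : 'M[F]_0) : A == B by apply/eqP; rewrite (flatmx0 A) (flatmx0 B).
by rewrite /B4m_rel !e.
Qed.

Definition zero_bmod : bmod F m := mk_bmod zero_rel.

(** This reduces the equality of the classes of V and W to [cls_zero], which
    is itself the case of the identity of the zero module. *)
Lemma ses_iso (V W : bmod F m) (f : 'M[F]_(dim W, dim V)) :
  is_iso f -> ses V W zero_bmod.
Proof.
case=> hf [g [fg gf]].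
exists f, 0; split=> //.
- by split; exact: etrans (flatmx0 _) (esym (flatmx0 _)).
- by move=> u fu0; rewrite -[u]mul1mx -gf -mulmxA fu0 mulmx0.
- by move=> w; exists 0; exact: etrans (flatmx0 _) (esym (flatmx0 _)).
- move=> w; split=> _; last by rewrite mul0mx.
  by exists (g *m w); rewrite mulmxA fg mul1mx.
Qed.

Lemma cls_zero : cls zero_bmod = 0.
Proof.
have iso1 : @is_iso _ _ zero_bmod zero_bmod 1%:M.
  by split; [exact: hom1 | exists 1%:M; rewrite mul1mx].
by apply: (addIr (cls zero_bmod)); rewrite -(cls_ses (ses_iso iso1)) add0r.
Qed.

Lemma cls_iso (V W : bmod F m) (f : 'M[F]_(dim W, dim V)) :
  is_iso f -> cls V = cls W.
Proof. by move=> /ses_iso/cls_ses; rewrite cls_zero addr0. Qed.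

Lemma cls_dsum (V W : bmod F m) : cls (dsum V W) = cls V + cls W.
Proof.
apply/cls_ses/(@ses_of_split _ _ _ (dsum V W) _ (col_mx 1%:M 0) (row_mx 0 1%:M)
  (row_mx 1%:M 0) (col_mx 0 1%:M)).
- by apply: hom_gens; rewrite mul_col_mx mul_block_col
    !mul0mx !mulmx0 mul1mx mulmx1 !addr0.
- by apply: hom_gens; rewrite mul_mx_row mul_row_block
    !mul0mx !mulmx0 mul1mx mulmx1 !add0r.
- by rewrite mul_row_col mulmx1 mul0mx addr0.
- by rewrite mul_row_col mulmx1 mul0mx add0r.
- by rewrite mul_row_col mulmx0 mul0mx addr0.
- rewrite !mul_col_row !mulmx1 !mulmx0 add_block_mx !addr0 !add0r.
  by rewrite -scalar_mx_block.
Qed.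

Lemma fusion1_iso (V W U : bmod F m) b :
  @is_iso F m U (tens V W) b -> @fusion1 F m V W U b.
Proof. by move=> hb; split; rewrite // -clsM (cls_iso hb). Qed.

Lemma fusion2_iso (V W U1 U2 : bmod F m) b1 b2 :
  @is_iso F m (dsum U1 U2) (tens V W) (row_mx b1 b2) ->
  @fusion2 F m V W U1 b1 U2 b2.
Proof. by move=> hb; split; rewrite // -clsM -(cls_iso hb) cls_dsum. Qed.

(** The dimensions are kept as two variables because those of a tensor product
    and of a direct sum are equal only up to computation. *)
Lemma mulmx1C_dim n n' (f : 'M[F]_(n, n')) (g : 'M[F]_(n', n)) :
  n = n' -> f *m g = 1%:M -> g *m f = 1%:M.
Proof. by move=> e; case: n' / e f g => f g; exact: mulmx1C. Qed.

Lemma iso_of_right_inverse (V W : bmod F m) (f : 'M[F]_(dim W, dim V)) g :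
  is_hom f -> dim W = dim V -> f *m g = 1%:M -> is_iso f.
Proof.
by move=> hf e fg; split=> //; exists g; split=> //; exact: mulmx1C_dim fg.
Qed.

Lemma hom_dsum (V1 V2 W : bmod F m) (f1 : 'M[F]_(dim W, dim V1)) f2 :
  is_hom f1 -> is_hom f2 -> @is_hom F m (dsum V1 V2) W (row_mx f1 f2).
Proof.
move=> [p1 m1 _] [p2 m2 _]; apply: hom_gens.
- by rewrite mul_row_block !mulmx0 addr0 add0r p1 p2 mul_mx_row.
- by rewrite mul_row_block !mulmx0 addr0 add0r m1 m2 mul_mx_row.
Qed.

Lemma hom_Tmod (c1 c2 c3 : F) (h : T_ok m c1 c2 c3) (M : bmod F m)
    (p : 'cV[F]_(dim M)) :
  act_sp M *m p = c1 *: p -> act_sm M *m p = c2 *: p ->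
  @is_hom F m (Tmod c1 c2 c3 h) M p.
Proof.
by move=> hp hm; apply: hom_gens; rewrite ?hp ?hm [LHS]mul_mx_scalar.
Qed.

Lemma basis2_mx2 n (p q : 'cV[F]_n) (a b c d : F) :
  basis2 p q *m mx2 a b c d = basis2 (a *: p + c *: q) (b *: p + d *: q).
Proof.
have -> : mx2 a b c d = block_mx a%:M b%:M c%:M d%:M :> 'M_(1 + 1).
  by apply/matrixP => -[[|[|//]] ?] -[[|[|//]] ?]; rewrite /block_mx !mxE;
    do 3?[case: splitP => [[[|//] ?]|[[|//] ?]] //= _; rewrite ?mxE].
by move: (mul_row_block p q a%:M b%:M c%:M d%:M); rewrite !mul_mx_scalar.
Qed.

Lemma mul_basis2 n (A : 'M[F]_n) p q :
  A *m basis2 p q = basis2 (A *m p) (A *m q).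
Proof. by move: (mul_mx_row A p q). Qed.

End Homomorphisms.

(** * Weight pairs *)

Section WeightPairs.
Variables (F : numFieldType) (m : nat).

(** The matrices E and G are the contributions of p and q to a resolution of
    the identity.  They are parameters, so that the contributions of several
    pairs can be added up. *)
Record weight_pair (M : bmod F m) (z : F) (p q : 'cV[F]_(dim M))
    (E G : 'M[F]_(dim M)) : Prop := WeightPair {
  wp_sp : act_sp M *m p = q;
  wp_sm : act_sm M *m p = z *: q;
  wp_fst : exists p' : 'rV_(dim M), p *m p' = E;
  wp_snd : exists q' : 'rV_(dim M), q *m q' = G }.

(** s_+ and s_- are involutions, so they take q back to p and z^-1 p. *)
Lemma wp_swap M z p q E G : z != 0 -> @weight_pair M z p q E G ->
  @weight_pair M z^-1 q p G E.
Proof.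
move=> z0 [hp hm hE hG]; split=> //.
- by rewrite -hp mulmxA act_spsp mul1mx.
- apply: (scalerI z0); rewrite scalerA mulfV // scale1r scalemxAr -hm.
  by rewrite mulmxA act_smsm mul1mx.
Qed.

(** s_+ s_- p = z s_+ q = z p, and a is the m-th power of s_+ s_-. *)
Lemma wp_act_a M z p q E G : @weight_pair M z p q E G ->
  act_a M *m p = z ^+ m *: p.
Proof.
move=> [hp hm _ _]; rewrite -act_pow.
have Xp k : (act_sp M * act_sm M) ^+ k *m p = z ^+ k *: p.
  elim: k => [|k IH]; first by rewrite !expr0 mul1mx scale1r.
  rewrite exprSr -![_ * _]/(_ *m _) -!mulmxA hm -!scalemxAr.
  by rewrite -{1}hp (mulmxA (act_sp M)) act_spsp mul1mx IH scalerA -exprS.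
exact: Xp.
Qed.

Lemma tensvZl (V W : bmod F m) c (v : 'cV[F]_(dim V)) (w : 'cV[F]_(dim W)) :
  tensv (c *: v) w = c *: tensv v w.
Proof. by apply/matrixP => i j; rewrite !mxE mulrA. Qed.

Lemma tensvZr (V W : bmod F m) c (v : 'cV[F]_(dim V)) (w : 'cV[F]_(dim W)) :
  tensv v (c *: w) = c *: tensv v w.
Proof. by apply/matrixP => i j; rewrite !mxE mulrCA. Qed.

Lemma tensv_factor (V W : bmod F m) (p : 'cV[F]_(dim V)) (x : 'cV[F]_(dim W))
    E E' :
  (exists p' : 'rV_(dim V), p *m p' = E) ->
  (exists x' : 'rV_(dim W), x *m x' = E') ->
  exists r : 'rV_(dim (tens V W)), tensv p x *m r = tensmx E E'.
Proof.
by move=> [p' <-] [x' <-]; exists (tensmx p' x'); move: (tensmx_mul p x p' x').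
Qed.

Lemma scale_factor n (c : F) (p : 'cV[F]_n) (E : 'M[F]_n) : c != 0 ->
  (exists p' : 'rV_n, p *m p' = E) -> exists p' : 'rV_n, (c *: p) *m p' = E.
Proof.
move=> c0 [p' <-]; exists (c^-1 *: p').
by rewrite -scalemxAl -scalemxAr scalerA mulfV // scale1r.
Qed.

Lemma tensmx_tensv (V W : bmod F m) (A : 'M[F]_(dim V)) (B : 'M[F]_(dim W))
    v w :
  tensmx A B *m tensv v w = tensv (A *m v) (B *m w) :> 'cV_(dim (tens V W)).
Proof. by move: (tensmx_mul A B v w). Qed.

(** On the vectors fixed by a, the idempotents e_0 and e_1 act as 1 and 0, which
    leaves only the first term of each coproduct; on those negated by a, only
    the second. *)
Lemma act_tens_even (V W : bmod F m) v w : act_a W *m w = w ->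
  act_sp (tens V W) *m tensv v w = tensv (act_sp V *m v) (act_sp W *m w) /\
  act_sm (tens V W) *m tensv v w = tensv (act_sm V *m v) (act_sm W *m w).
Proof.
move=> aw.
have e0w : act_e0 W *m w = w.
  rewrite /act_e0 -scalemxAl mulmxDl mul1mx aw.
  by rewrite scalerDr -scalerDl half2 scale1r.
have e1w : act_e1 W *m w = 0.
  by rewrite /act_e1 -scalemxAl mulmxBl mul1mx aw subrr scaler0.
split; apply: etrans (mulmxDl _ _ _) _.
all: rewrite !tensmx_tensv -?spe0 -?spe1 -?sme0 -?sme1.
all: by rewrite -!mulmxA e0w e1w !mulmx0 [tensv _ 0]tensmx0 addr0.
Qed.

Lemma act_tens_odd (V W : bmod F m) v w : act_a W *m w = - w ->
  act_sp (tens V W) *m tensv v w = tensv (act_sm V *m v) (act_sp W *m w) /\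
  act_sm (tens V W) *m tensv v w = tensv (act_sp V *m v) (act_sm W *m w).
Proof.
move=> aw.
have e0w : act_e0 W *m w = 0.
  by rewrite /act_e0 -scalemxAl mulmxDl mul1mx aw subrr scaler0.
have e1w : act_e1 W *m w = w.
  rewrite /act_e1 -scalemxAl mulmxBl mul1mx aw opprK.
  by rewrite scalerDr -scalerDl half2 scale1r.
split; apply: etrans (mulmxDl _ _ _) _.
all: rewrite !tensmx_tensv -?spe0 -?spe1 -?sme0 -?sme1.
all: by rewrite -!mulmxA e0w e1w !mulmx0 [tensv _ 0]tensmx0 add0r.
Qed.

Lemma wp_tens_even V W z w p q x y E G E' G' : w ^+ m = 1 ->
  @weight_pair V z p q E G -> @weight_pair W w x y E' G' ->
  @weight_pair (tens V W) (z * w) (tensv p x) (tensv q y)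
    (tensmx E E') (tensmx G G').
Proof.
move=> wm hV hW; have [hp hm hE hG] := hV; have [hx hn hE' hG'] := hW.
have ax : act_a W *m x = x by rewrite (wp_act_a hW) wm scale1r.
have [tp tm] := act_tens_even p ax.
split; [by rewrite tp hp hx | | exact: tensv_factor | exact: tensv_factor].
by rewrite tm hm hn tensvZl tensvZr scalerA.
Qed.

(** As s_+ (p (x) x) = s_- p (x) s_+ x, the second vector picks up the factor z;
    s_- (p (x) x) = s_+ p (x) s_- x = w (q (x) y) does not, whence the z^-1. *)
Lemma wp_tens_odd V W z w p q x y E G E' G' : z != 0 -> w ^+ m = -1 ->
  @weight_pair V z p q E G -> @weight_pair W w x y E' G' ->
  @weight_pair (tens V W) (z^-1 * w) (tensv p x) (z *: tensv q y)
    (tensmx E E') (tensmx G G').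
Proof.
move=> z0 wm hV hW; have [hp hm hE hG] := hV; have [hx hn hE' hG'] := hW.
have ax : act_a W *m x = - x by rewrite (wp_act_a hW) wm scaleN1r.
have [tp tm] := act_tens_odd p ax.
split; [by rewrite tp hm hx tensvZl | | exact: tensv_factor
       | exact/scale_factor/tensv_factor].
by rewrite tm hp hn tensvZr scalerA mulrAC mulVf // mul1r.
Qed.

(** In a one-dimensional module p and q are proportional, so that each of them
    alone resolves the identity. *)
Lemma wp_Tmod (c1 c2 c3 : F) (h : T_ok m c1 c2 c3) :
  weight_pair (c1 * c2) (T_t h) (c1 *: T_t h) 1%:M 1%:M.
Proof.
have /and4P[/eqP h1 _ _ _] := h.
have c10 : c1 != 0.
  by apply/eqP => c0; move/eqP: h1; rewrite c0 expr0n eq_sym oner_eq0.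
have t1 : exists p' : 'rV[F]_1, T_t h *m p' = 1%:M.
  exists (delta_mx 0 0); rewrite [LHS]mul_delta_mx.
  by apply/matrixP => i j; rewrite !ord1 !mxE.
split; [exact: mul_scalar_mx | | exact: t1 | exact/scale_factor/t1].
by rewrite scalerA mulrAC -expr2 h1 mul1r; exact: mul_scalar_mx.
Qed.

Lemma iso_Tmod (c1 c2 c3 : F) (h : T_ok m c1 c2 c3) M z p E G :
  dim M = 1 -> E = 1%:M -> z * c1 = c2 -> @weight_pair M z p (c1 *: p) E G ->
  @is_iso F m (Tmod c1 c2 c3 h) M p.
Proof.
move=> dM E1 zc [hp hs [g pg] _].
have hom_p : @is_hom F m (Tmod c1 c2 c3 h) M p.
  by apply: hom_Tmod; rewrite ?hs ?scalerA ?zc.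
by apply: (iso_of_right_inverse hom_p dM); exact: etrans pg E1.
Qed.

End WeightPairs.

(** * The modules pi_k inside a module *)

Section PiModules.
Variables (R : realType) (m : nat) (hm : (1 < m)%N).
Local Notation la := (lambda R m).
Local Notation P := (@pimod R m hm).

Lemma lambdaX_neq0 k : la ^+ k != 0.
Proof. by rewrite expf_neq0 ?lambda_neq0. Qed.

Lemma lambdaX_m k : (la ^+ k) ^+ m = (-1) ^+ k.
Proof. by rewrite exprAC lambda_m. Qed.

Lemma lambdaXB i j : (j <= i)%N -> la ^+ i / la ^+ j = la ^+ (i - j).
Proof. by move=> ji; rewrite expfB_cond ?(negbTE (lambda_neq0 _ _)). Qed.

Lemma lambdaXV_sum i j : (i < m)%N -> (j < m)%N ->
  la ^- (i + j) = la ^+ (2 * m - i - j).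
Proof.
move=> im jm; apply: (mulfI (lambdaX_neq0 (i + j))).
rewrite mulfV ?lambdaX_neq0 // -exprD.
have -> : (i + j + (2 * m - i - j) = m * 2)%N by lia.
by rewrite exprM lambda_m // sqrrN expr1n.
Qed.

Lemma lambdaX_subm i : (i <= m)%N -> la ^+ (m - i) = (- la ^+ i)^-1.
Proof. by move=> im; rewrite -lambdaXB // lambda_m // invrN mulN1r. Qed.

(** A weight pair with eigenvalue lambda^k is a copy of the basis of pi_k: the
    action on q follows from the one on p by [wp_swap]. *)
Lemma hom_pimod M k p q E G : weight_pair (la ^+ k) p q E G ->
  @is_hom _ m (P k) M (basis2 p q).
Proof.
move=> h; have lak0 := lambdaX_neq0 k.
have [hp hs _ _] := h; have [hp' hs' _ _] := wp_swap lak0 h.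
by apply: hom_gens; rewrite basis2_mx2 !scale0r ?scale1r ?addr0 ?add0r
  mul_basis2 ?hp ?hp' ?hs ?hs'.
Qed.

Lemma wp_pimod k : weight_pair (la ^+ k) (pi_u R hm k) (pi_v R hm k)
  (delta_mx 0 0 : 'M_2) (delta_mx 1 1 : 'M_2).
Proof.
split.
1,2: apply/matrixP => -[[|[|//]] ?] j; rewrite !ord1 !mxE.
1-4: rewrite !big_ord_recl big_ord0 !mxE /=.
1-4: by rewrite ?(mulr0, mul0r, mulr1, addr0, add0r).
- by exists (delta_mx 0 0 : 'rV_2); exact: mul_delta_mx.
- by exists (delta_mx 0 1 : 'rV_2); exact: mul_delta_mx.
Qed.

Lemma delta_mx_sum2 : delta_mx 0 0 + delta_mx 1 1 = 1%:M :> 'M[R[i]]_2.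
Proof.
by apply/matrixP => -[[|[|//]] ?] -[[|[|//]] ?];
  rewrite !mxE /= ?addr0 ?add0r.
Qed.

Lemma basis2_factor (F : numFieldType) n (p q : 'cV[F]_n) E G :
  (exists p' : 'rV_n, p *m p' = E) -> (exists q' : 'rV_n, q *m q' = G) ->
  exists r : 'M_(2, n), basis2 p q *m r = E + G.
Proof.
move=> [p' <-] [q' <-]; exists (col_mx p' q' : 'M_(1 + 1, n)).
by rewrite -mul_row_col.
Qed.

Lemma iso_pimod M k p q E G : dim M = 2 -> E + G = 1%:M ->
  weight_pair (la ^+ k) p q E G -> @is_iso _ m (P k) M (basis2 p q).
Proof.
move=> dM e h; have [_ _ hE hG] := h; have [g hg] := basis2_factor hE hG.
by apply: (iso_of_right_inverse (hom_pimod h) dM); exact: etrans hg e.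
Qed.

Lemma iso_pimod2 M k l p q x y E G E' G' :
  dim M = 4 -> E + G + (E' + G') = 1%:M ->
  weight_pair (la ^+ k) p q E G -> weight_pair (la ^+ l) x y E' G' ->
  @is_iso _ m (dsum (P k) (P l)) M (row_mx (basis2 p q) (basis2 x y)).
Proof.
move=> dM e h h'; have [_ _ hE hG] := h; have [g hg] := basis2_factor hE hG.
have [_ _ hE' hG'] := h'; have [g' hg'] := basis2_factor hE' hG'.
apply: (@iso_of_right_inverse _ _ (dsum (P k) (P l)) M _ (col_mx g g')) => //.
  by apply: hom_dsum; [exact: hom_pimod h | exact: hom_pimod h'].
by move: (mul_row_col (basis2 p q) (basis2 x y) g g'); rewrite hg hg' e.
Qed.

Lemma tens_delta_mx_sum :
  tensmx (delta_mx 0 0) (delta_mx 1 1) + tensmx (delta_mx 1 1) (delta_mx 0 0) +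
  (tensmx (delta_mx 0 0) (delta_mx 0 0) + tensmx (delta_mx 1 1) (delta_mx 1 1))
  = 1%:M :> 'M[R[i]]_(2 * 2).
Proof.
rewrite -tensmx11 -delta_mx_sum2 !(tensmxDl, tensmxDr).
by rewrite [LHS](AC (2*2) ((3*1)*(2*4))).
Qed.

End PiModules.

(** * The fusion rules *)

Theorem theorem4p3 (R : realType) (m : nat) (hm : (1 < m)%N) :
  let la := lambda R m in
  let P := @pimod R m hm in
  let u := @pi_u R m hm in
  let v := @pi_v R m hm in
  (forall i j : nat, (0 < i < m)%N -> (0 < j < m)%N -> ~~ odd j ->
    let ux := tensv (u i) (u j) in let uy := tensv (u i) (v j) in
    let vx := tensv (v i) (u j) in let vy := tensv (v i) (v j) in
    [/\ (i + j <= m - 1)%N -> (j <= i)%N ->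
          fusion2 (U1 := P (i - j)%N) (basis2 uy vx)
                  (U2 := P (i + j)%N) (basis2 ux vy),
        (i + j <= m - 1)%N -> (i <= j)%N ->
          fusion2 (U1 := P (j - i)%N) (basis2 vx uy)
                  (U2 := P (i + j)%N) (basis2 ux vy),
        (m - 1 < i + j)%N -> (j <= i)%N ->
          fusion2 (U1 := P (i - j)%N) (basis2 uy vx)
                  (U2 := P (2 * m - i - j)%N) (basis2 vy ux) &
        (m - 1 < i + j)%N -> (i <= j)%N ->
          fusion2 (U1 := P (j - i)%N) (basis2 vx uy)
                  (U2 := P (2 * m - i - j)%N) (basis2 vy ux)]) /\
  (forall i j : nat, (0 < i < m)%N -> (0 < j < m)%N -> odd j ->
    let ux := tensv (u i) (u j) in let uy := tensv (u i) (v j) in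
    let vx := tensv (v i) (u j) in let vy := tensv (v i) (v j) in
    [/\ (i + j <= m - 1)%N -> (j <= i)%N ->
          fusion2 (U1 := P (i - j)%N) (basis2 (la ^+ i *: vy) ux)
                  (U2 := P (i + j)%N) (basis2 (la ^+ i *: vx) uy),
        (i + j <= m - 1)%N -> (i <= j)%N ->
          fusion2 (U1 := P (j - i)%N) (basis2 ux (la ^+ i *: vy))
                  (U2 := P (i + j)%N) (basis2 (la ^+ i *: vx) uy),
        (m - 1 < i + j)%N -> (j <= i)%N ->
          fusion2 (U1 := P (i - j)%N) (basis2 (la ^+ i *: vy) ux)
                  (U2 := P (2 * m - i - j)%N) (basis2 uy (la ^+ i *: vx)) &
        (m - 1 < i + j)%N -> (i <= j)%N ->
          fusion2 (U1 := P (j - i)%N) (basis2 ux (la ^+ i *: vy))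
                  (U2 := P (2 * m - i - j)%N) (basis2 uy (la ^+ i *: vx))]) /\
  (forall (i : nat) (d : R[i]) (hd : is_sign d), (0 < i < m)%N ->
    let T1 := Tmod d d 1 (T_ok_same m hd) in
    let t1 := T_t (T_ok_same m hd) in
    let T2 := Tmod d (- d) ((-1) ^+ m) (T_ok_opp m hd) in
    let t2 := T_t (T_ok_opp m hd) in
    [/\ fusion1 (V := T1) (W := P i) (U := P i)
          (basis2 (tensv t1 (u i)) (d *: tensv t1 (v i))),
        fusion1 (V := P i) (W := T1) (U := P i)
          (basis2 (tensv (u i) t1) (d *: tensv (v i) t1)),
        fusion1 (V := T2) (W := P i) (U := P (m - i)%N)
          (basis2 ((d * (-1) ^+ i) *: tensv t2 (v i)) (tensv t2 (u i))) &
        (* For m odd the generator a acts by -1 on T2, so s_+ (v t2) is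
           d * la ^- i times u t2, and the basis adapted to pi_(m - i) is
           (u t2, d * la ^+ i * v t2). *)
        fusion1 (V := P i) (W := T2) (U := P (m - i)%N)
          (if odd m then basis2 (tensv (u i) t2) ((d * la ^+ i) *: tensv (v i) t2)
           else basis2 ((d * (-1) ^+ m) *: tensv (v i) t2) (tensv (u i) t2))]) /\
  (forall (d e : R[i]) (hd : is_sign d) (he : is_sign e),
    let T2 := Tmod d (- d) ((-1) ^+ m) (T_ok_opp m hd) in
    let t := T_t (T_ok_opp m hd) in
    let T1 := Tmod e e 1 (T_ok_same m he) in
    let s := T_t (T_ok_same m he) in
    fusion1 (V := T2) (W := T1)
      (U := Tmod (d * e) (- (d * e)) ((-1) ^+ m) (T_ok_opp m (is_signM hd he)))
      (tensv t s) /\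
    fusion1 (V := T1) (W := T2)
      (U := Tmod (e * d) (- (e * d)) ((-1) ^+ m) (T_ok_opp m (is_signM he hd)))
      (tensv s t)).
Proof.
move=> la P u v.
have l0 := lambdaX_neq0 R m.
split; [|split; [|split]].
- move=> i j /andP[_ im] /andP[_ jm] jE ux uy vx vy.
  have wj : (la ^+ j) ^+ m = 1 by rewrite lambdaX_m // -signr_odd (negbTE jE).
  have wj' : (la ^- j) ^+ m = 1 by rewrite exprVn wj invr1.
  (* D is the pair (ux, vy) and X the pair (uy, vx); the eigenvalue of X comes
     from exchanging the basis vectors of the second factor. *)
  have D := wp_tens_even wj (wp_pimod R hm i) (wp_pimod R hm j).
  have X :=
    wp_tens_even wj' (wp_pimod R hm i) (wp_swap (l0 j) (wp_pimod R hm j)).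
  have D' := wp_swap (mulf_neq0 (l0 i) (l0 j)) D.
  have X' := wp_swap (mulf_neq0 (l0 i) (invr_neq0 (l0 j))) X.
  move: D D' X X'; rewrite -exprD invfM invrK [_^-1 * _]mulrC => D D' X X'.
  have V := lambdaXV_sum R hm im jm.
  split=> h1 h2; apply: fusion2_iso.
  + rewrite lambdaXB // in X; apply: iso_pimod2 X D => //.
    exact: tens_delta_mx_sum.
  + rewrite lambdaXB // in X'; apply: iso_pimod2 X' D => //.
    by rewrite -tens_delta_mx_sum [LHS](AC (2*2) ((2*1)*(3*4))).
  + rewrite lambdaXB // in X; rewrite V in D'.
    apply: iso_pimod2 X D' => //.
    by rewrite -tens_delta_mx_sum [LHS](AC (2*2) ((1*2)*(4*3))).
  + rewrite lambdaXB // in X'; rewrite V in D'.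
    apply: iso_pimod2 X' D' => //.
    by rewrite -tens_delta_mx_sum [LHS](AC (2*2) ((2*1)*(4*3))).
- move=> i j /andP[_ im] /andP[_ jm] jO ux uy vx vy.
  have wj : (la ^+ j) ^+ m = -1 by rewrite lambdaX_m // -signr_odd jO.
  have wj' : (la ^- j) ^+ m = -1 by rewrite exprVn wj invrN1.
  (* D is the pair (ux, lambda^i vy) and X the pair (uy, lambda^i vx), with
     eigenvalues lambda^(j - i) and lambda^(- i - j). *)
  have D := wp_tens_odd (l0 i) wj (wp_pimod R hm i) (wp_pimod R hm j).
  have X := wp_tens_odd (l0 i) wj'
    (wp_pimod R hm i) (wp_swap (l0 j) (wp_pimod R hm j)).
  have D' := wp_swap (mulf_neq0 (invr_neq0 (l0 i)) (l0 j)) D.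
  have X' := wp_swap (mulf_neq0 (invr_neq0 (l0 i)) (invr_neq0 (l0 j))) X.
  move: D D' X X'; rewrite -invfM invrK -exprD invfM invrK [la ^- i * _]mulrC.
  move=> D D' X X'.
  have V := lambdaXV_sum R hm im jm.
  split=> h1 h2; apply: fusion2_iso.
  + rewrite lambdaXB // in D'; apply: iso_pimod2 D' X' => //.
    by rewrite -tens_delta_mx_sum [LHS](AC (2*2) ((4*3)*(2*1))).
  + rewrite lambdaXB // in D; apply: iso_pimod2 D X' => //.
    by rewrite -tens_delta_mx_sum [LHS](AC (2*2) ((4*3)*(1*2))).
  + rewrite lambdaXB // in D'; rewrite V in X.
    apply: iso_pimod2 D' X => //.
    by rewrite -tens_delta_mx_sum [LHS](AC (2*2) ((3*4)*(2*1))).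
  + rewrite lambdaXB // in D; rewrite V in X.
    apply: iso_pimod2 D X => //.
    by rewrite -tens_delta_mx_sum [LHS](AC (2*2) ((3*4)*(1*2))).
- move=> i d hd /andP[_ im] T1 t1 T2 t2.
  have dd : d * d = 1 by rewrite -expr2 is_signP.
  have w1 := wp_Tmod (T_ok_same m hd); have w2 := wp_Tmod (T_ok_opp m hd).
  move: w1 w2; rewrite mulrN dd -/t1 -/t2 => w1 w2.
  have wi := wp_pimod R hm i.
  split; apply: fusion1_iso.
  (* The eigenvalue 1 of T1 makes both parities of i give lambda^i. *)
  + have [iO|iE] := boolP (odd i).
      have wm : (la ^+ i) ^+ m = -1 by rewrite lambdaX_m // -signr_odd iO.
      have := wp_tens_odd (oner_neq0 _) wm w1 wi.
      rewrite invr1 mul1r scale1r tensvZl; apply: iso_pimod => //.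
      by rewrite -tensmxDr delta_mx_sum2 tensmx11.
    have wm : (la ^+ i) ^+ m = 1 by rewrite lambdaX_m // -signr_odd (negbTE iE).
    have := wp_tens_even wm w1 wi.
    rewrite mul1r tensvZl; apply: iso_pimod => //.
    by rewrite -tensmxDr delta_mx_sum2 tensmx11.
  + have := wp_tens_even (expr1n _ m) wi w1.
    rewrite mulr1 tensvZr; apply: iso_pimod => //.
    by rewrite -tensmxDl delta_mx_sum2 tensmx11.
  (* The eigenvalue -1 of T2 turns lambda^i into - lambda^i, the inverse of
     lambda^(m - i), for both parities of i. *)
  + have [iO|iE] := boolP (odd i).
      have wm : (la ^+ i) ^+ m = -1 by rewrite lambdaX_m // -signr_odd iO.
      have n1 : -1 != 0 :> R[i] by rewrite oppr_eq0 oner_eq0.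
      have := wp_tens_odd n1 wm w2 wi.
      rewrite invrN1 mulN1r tensvZl scalerA mulN1r => w.
      have := wp_swap _ w; rewrite oppr_eq0 => /(_ (l0 i)).
      rewrite -lambdaX_subm ?(ltnW im) // => {}w.
      have -> : d * (-1) ^+ i = - d by rewrite -signr_odd iO mulrN1.
      apply: iso_pimod w => //.
      by rewrite -tensmxDr addrC delta_mx_sum2 tensmx11.
    have wm : (la ^+ i) ^+ m = 1 by rewrite lambdaX_m // -signr_odd (negbTE iE).
    have := wp_tens_even wm w2 wi.
    rewrite mulN1r tensvZl => w.
    have := wp_swap _ w; rewrite oppr_eq0 => /(_ (l0 i)).
    rewrite -lambdaX_subm ?(ltnW im) // => {}w.
    have -> : d * (-1) ^+ i = d by rewrite -signr_odd (negbTE iE) mulr1.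
    apply: iso_pimod w => //.
    by rewrite -tensmxDr addrC delta_mx_sum2 tensmx11.
  (* For m odd, a acts by -1 on T2 and the eigenvalue is - lambda^-i, which is
     already lambda^(m - i); for m even it is - lambda^i, and the pair has to be
     exchanged. *)
  + have [mO|mE] := boolP (odd m).
      have wm : (-1 : R[i]) ^+ m = -1 by rewrite -signr_odd mO.
      have := wp_tens_odd (l0 i) wm wi w2.
      rewrite mulrN1 -invrN -lambdaX_subm ?(ltnW im) // tensvZr scalerA.
      rewrite [_ * d]mulrC.
      by apply: iso_pimod; rewrite // -tensmxDl delta_mx_sum2 tensmx11.
    have wm : (-1 : R[i]) ^+ m = 1 by rewrite -signr_odd (negbTE mE).
    have := wp_tens_even wm wi w2.
    rewrite mulrN1 tensvZr => w.
    have := wp_swap _ w; rewrite oppr_eq0 => /(_ (l0 i)).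
    rewrite -lambdaX_subm ?(ltnW im) // => {}w.
    have -> : d * (-1) ^+ m = d by rewrite wm mulr1.
    apply: iso_pimod w => //.
    by rewrite -tensmxDl addrC delta_mx_sum2 tensmx11.
- move=> d e hd he T2 t T1 s.
  have dd : d * d = 1 by rewrite -expr2 is_signP.
  have ee : e * e = 1 by rewrite -expr2 is_signP.
  have w2 := wp_Tmod (T_ok_opp m hd); have w1 := wp_Tmod (T_ok_same m he).
  move: w1 w2; rewrite mulrN dd ee -/t -/s => w1 w2.
  split; apply: fusion1_iso.
  + have := wp_tens_even (expr1n _ m) w2 w1.
    rewrite mulr1 tensvZl tensvZr scalerA.
    by apply: iso_Tmod; rewrite ?mulN1r // tensmx11.
  + have [mO|mE] := boolP (odd m).
      have wm : (-1 : R[i]) ^+ m = -1 by rewrite -signr_odd mO.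
      have := wp_tens_odd (oner_neq0 _) wm w1 w2.
      rewrite invr1 mul1r scale1r tensvZl tensvZr scalerA.
      by apply: iso_Tmod; rewrite ?mulN1r // tensmx11.
    have wm : (-1 : R[i]) ^+ m = 1 by rewrite -signr_odd (negbTE mE).
    have := wp_tens_even wm w1 w2; rewrite mul1r tensvZl tensvZr scalerA.
    by apply: iso_Tmod; rewrite ?mulN1r // tensmx11.
Qed.
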